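(* There is a four-arm instance with two overlapping groups (arm degree $t=2$) on which any rule whose covering pulls select an index-maximizing member of some deficient group and whose surplus pulls select the global index argmax (that is, the algorithm D-BDQ-UCB, designed for disjoint groups, applied verbatim) is exactly feasible yet, on the concentration event $\mathcal E$, suffers regret at least $$\frac{T}{20}-CL$$ against $\mathrm{OPT}^{\mathrm{frac}}$, for a universal constant $C$.
   Context: An instance consists of $K$ arms (here $K=4$), arm $i$ producing independent $[0,1]$-valued rewards of mean $\mu_i$; a collection $\mathcal G$ of groups (subsets of arms); a horizon $T$ partitioned into consecutive blocks, block $b$ of length $H_b$; and group floors $f_{b,g}$. A pull sequence is feasible if in every block $b$ every group $g$ receives in aggregate at least $f_{b,g}$ pulls of its members. The arm degree $t$ is the maximum number of groups containing a single arm. The deficit $d_g(\tau)$ of group $g$ is its remaining unmet floor in the current block just before round $\tau$; a group is deficient while its deficit is positive. $\mathrm{OPT}^{\mathrm{frac}}=\sum_b\max\{\langle\mu,y\rangle:\ y\ge0,\ \sum_{i\in g}y_i\ge f_{b,g}\ \forall g\in\mathcal G,\ \sum_iy_i=H_b\}$, and the regret is $\mathrm{OPT}^{\mathrm{frac}}-\sum_{\tau=1}^T\mu_{A_\tau}$, where $A_\tau$ is the arm pulled at round $\tau$. Indices: $U_i=\min\{1,\widehat\mu_i+\sqrt{2L/N_i}\}$, where $N_i$ and $\widehat\mu_i$ are the pull count and empirical mean of arm $i$ from all observations so far, $L=\log(2KT/\eta)$, and $\eta\in(0,1)$ is a failure probability; unobserved arms are treated optimistically (maximal index). D-BDQ-UCB: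 in each block $b$ execute exactly $f_{b,g}$ covering pulls for every group $g$, each selecting an index-maximizing member $\arg\max_{i\in g}U_i$ (indices updated after every pull), and spend the surplus $H_b-\sum_gf_{b,g}$ rounds by pulling the global index argmax $\arg\max_iU_i$ over all arms. $\mathcal E$ is the event that for every arm $i$ and every $n\in\{1,\dots,T\}$ the empirical mean of the first $n$ rewards of arm $i$ is within $\sqrt{2L/n}$ of $\mu_i$. *)

(* Defs.v *)
From HB Require Import structures.
From mathcomp Require Import all_boot all_order all_algebra.
From mathcomp Require Import all_classical all_reals all_analysis.
Set Implicit Arguments.
Unset Strict Implicit.
Unset Printing Implicit Defensive.
Import Order.TTheory GRing.Theory Num.Theory.
Local Open Scope ring_scope.

(* Arms are 0, ..., K-1, rounds are 0, ..., T-1, and "just before round tau"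
   refers to the rounds s < tau.  A pull sequence is a function A : nat -> 'I_K
   of which only the values at rounds tau < T matter. *)

(* The arms enter through their means only; the reward process is tied to the
   means by [reward_process] below. *)
Record instance (R : realType) (K T : nat) := Instance {
  mean : 'I_K -> R;
  mean01 : forall i, 0 <= mean i <= 1;
  groups : {set {set 'I_K}};
  nblocks : nat;
  blen : 'I_nblocks -> nat;
  blen_gt0 : forall b, (0 < blen b)%N;
  blen_sum : (\sum_(b < nblocks) blen b)%N = T;
  gfloor : 'I_nblocks -> {set 'I_K} -> nat
}.

Definition arm_degree (K : nat) (G : {set {set 'I_K}}) : nat :=
  (\max_(i < K) #|[set g in G | i \in g]|)%N.

Section Blocks.
Context {R : realType} {K T : nat} (I : instance R K T).
Implicit Types (A : nat -> 'I_K) (b : 'I_(nblocks I)) (g : {set 'I_K}).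

Definition bstart b : nat := (\sum_(b' < nblocks I | (b' < b)%N) blen b')%N.
Definition bstop b : nat := (bstart b + blen b)%N.
Definition in_block b (tau : nat) : bool := (bstart b <= tau < bstop b)%N.

(* The surplus H_b - sum_g f_{b,g} of every block is nonnegative, so that the
   covering pulls fit in the block. *)
Definition covering_fits : Prop :=
  forall b, (\sum_(g in groups I) gfloor b g <= blen b)%N.

Definition group_pulls A g (s t : nat) : nat :=
  (\sum_(s <= u < t) (A u \in g))%N.

Definition feasible A : Prop :=
  forall b g, g \in groups I ->
    (gfloor b g <= group_pulls A g (bstart b) (bstop b))%N.

(* Truncated subtraction: the deficit is 0 once the floor is met. *)
Definition deficit A b g (tau : nat) : nat :=
  (gfloor b g - group_pulls A g (bstart b) tau)%N.

Definition LP_value (y : 'I_K -> R) : R := \sum_(i < K) mean I i * y i.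

Definition LP_feasible b (y : 'I_K -> R) : Prop :=
  [/\ forall i, 0 <= y i,
      forall g, g \in groups I -> (gfloor b g)%:R <= \sum_(i in g) y i
    & \sum_(i < K) y i = (blen b)%:R].

(* The polytope of each block is compact; when [covering_fits] holds and the
   groups are nonempty it is inhabited, so that this supremum is a maximum. *)
Definition OPTfrac : R :=
  \sum_(b < nblocks I)
    sup [set v | exists2 y, LP_feasible b y & v = LP_value y]%classic.

Definition regret A : R := OPTfrac - \sum_(tau < T) mean I (A tau).

End Blocks.

Section Indices.
Context {R : realType} {K : nat}.
(* x i n is the reward of the (n+1)-st pull of arm i *)
Implicit Types (x : 'I_K -> nat -> R) (A : nat -> 'I_K).

Definition log_term (T : nat) (eta : R) : R := ln (2 * K%:R * T%:R / eta).

Definition radius (L : R) (n : nat) : R := Num.sqrt (2 * L / n%:R).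

Definition emp_mean x (i : 'I_K) (n : nat) : R := (\sum_(m < n) x i m) / n%:R.

Definition npulls A (i : 'I_K) (tau : nat) : nat := (\sum_(s < tau) (A s == i))%N.

(* An unobserved arm gets the maximal index value 1.  Every index is at most 1,
   so an index-maximizing member for the convention that unobserved arms have
   index +oo is also one for this convention. *)
Definition ucb_index L x A (tau : nat) (i : 'I_K) : R :=
  if npulls A i tau == 0%N then 1
  else Num.min 1 (emp_mean x i (npulls A i tau) + radius L (npulls A i tau)).

Definition is_argmax (U : 'I_K -> R) (g : {set 'I_K}) (i : 'I_K) : Prop :=
  i \in g /\ forall j, j \in g -> U j <= U i.

End Indices.

Section Rules.
Context {R : realType} {K T : nat} (I : instance R K T).
Variables (L : R) (x : 'I_K -> nat -> R).
Implicit Types A : nat -> 'I_K.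

(* Each round is either a covering pull, for some group that is deficient at
   that round, or a surplus pull.  A surplus pull is available only when the
   rounds left in the block outnumber the total outstanding deficit; in
   particular it may always be made when no group is deficient, or when fewer
   than H_b - sum_g f_{b,g} surplus pulls have been made in the block.  The
   choice among deficient groups, the order of covering and surplus pulls and
   the tie-breaking are left free. *)
Definition deficient_index_rule A : Prop :=
  forall (b : 'I_(nblocks I)) (tau : nat), in_block b tau ->
    (exists g : {set 'I_K},
        [/\ g \in groups I, (0 < deficit A b g tau)%N
          & is_argmax (ucb_index L x A tau) g (A tau)]) \/
    ((\sum_(g in groups I) deficit A b g tau < bstop b - tau)%N /\
      is_argmax (ucb_index L x A tau) [set: 'I_K] (A tau)).

(* lab tau = Some g marks round tau as a covering pull executed for g, and
   lab tau = None as a surplus pull.  Exactly f_{b,g} pulls are executed for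
   each group g, whether or not pulls executed for other groups already count
   towards g; hence H_b - sum_g f_{b,g} surplus pulls remain. *)
Definition D_BDQ_UCB A : Prop :=
  exists lab : nat -> option {set 'I_K},
    (forall (b : 'I_(nblocks I)) (g : {set 'I_K}), g \in groups I ->
      (\sum_(bstart b <= u < bstop b) (lab u == Some g))%N = gfloor b g) /\
    (forall tau, (tau < T)%N ->
      match lab tau with
      | Some g => g \in groups I /\ is_argmax (ucb_index L x A tau) g (A tau)
      | None => is_argmax (ucb_index L x A tau) [set: 'I_K] (A tau)
      end).

End Rules.

Section Rewards.
Context {d : measure_display} {Omega : measurableType d} {R : realType}.
Variable P : probability Omega R.

Definition mutually_independent (J : choiceType) (X : J -> {RV P >-> R}) : Prop :=
  forall (s : seq J) (B : J -> set R), uniq s ->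
    (forall j, measurable (B j)) ->
    P [set w | forall j, j \in s -> B j (X j w)]%classic =
    (\prod_(j <- s) P (X j @^-1` B j)%classic)%E.

Definition reward_process (K : nat) (mu : 'I_K -> R)
    (X : 'I_K -> nat -> {RV P >-> R}) : Prop :=
  [/\ forall i n w, 0 <= X i n w <= 1,
      forall i n, ('E_P[X i n] = (mu i)%:E)%E
    & mutually_independent (fun p : 'I_K * nat => X p.1 p.2)].

Definition sample (K : nat) (X : 'I_K -> nat -> {RV P >-> R}) (w : Omega) :
  'I_K -> nat -> R := fun i n => X i n w.

Definition conc_event (K T : nat) (mu : 'I_K -> R) (L : R)
    (X : 'I_K -> nat -> {RV P >-> R}) : set Omega :=
  [set w | forall i n, (1 <= n <= T)%N ->
     `|emp_mean (sample X w) i n - mu i| <= radius L n]%classic.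

End Rewards.

(* Main.v *)
(* Take the groups {0, 2} and {1, 2}, both with floor T/2 in a single block of
   length T, and means 1/2, 1/2, 2/5, 1.  Pulling the shared arm 2 pays for both
   floors at once, leaving half of the rounds for the optimal arm 3.  But arm 2
   is the worst member of each group, so on the concentration event an index
   rule pulls it only O(L) times; each floor is then met by separate pulls of
   the private arms 0 and 1, which exhaust almost the whole horizon. *)
Require Import Defs.
From HB Require Import structures.
From mathcomp Require Import all_boot all_order all_algebra.
From mathcomp Require Import all_classical all_reals all_analysis.
From mathcomp Require Import zify lra.
Set Implicit Arguments.
Unset Strict Implicit.
Unset Printing Implicit Defensive.
Import Order.TTheory GRing.Theory Num.Theory.
Local Open Scope ring_scope.

(** * Counting pulls *)

Section Pulls.
Context {R : realType} {K : nat}.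
Implicit Types (A : nat -> 'I_K) (i : 'I_K) (g : {set 'I_K}).

Lemma npullsS A i n : npulls A i n.+1 = (npulls A i n + (A n == i))%N.
Proof. by rewrite /npulls big_ord_recr. Qed.

Lemma npulls_le A i n : (npulls A i n <= n)%N.
Proof.
by elim: n => [|n IHn]; [rewrite /npulls big_ord0 | rewrite npullsS; lia].
Qed.

(** Look at the last pull of [i] before [n]: at most [B] pulls precede it, and it adds one. *)
Lemma npulls_le_last A i n (B : R) : 0 <= B ->
  (forall tau, (tau < n)%N -> A tau = i -> (npulls A i tau)%:R <= B) ->
  (npulls A i n)%:R <= B + 1.
Proof.
move=> B0; elim: n => [|n IHn] HB.
  by rewrite /npulls big_ord0; lra.
rewrite npullsS; case: eqP => [Ani|_]; last first.
  by rewrite addn0; apply: IHn => tau /ltnW; apply: HB.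
by rewrite natrD lerD2r HB.
Qed.

Lemma sum_pullsE A (f : 'I_K -> R) n :
  \sum_(tau < n) f (A tau) = \sum_(i < K) f i * (npulls A i n)%:R.
Proof.
elim: n => [|n IHn].
  by rewrite big_ord0 big1 // => i _; rewrite /npulls big_ord0 mulr0.
rewrite big_ord_recr /= IHn (bigD1 (A n)) //= [RHS](bigD1 (A n)) //=.
rewrite npullsS eqxx natrD mulrDr mulr1 -!addrA; congr (_ + _).
rewrite addrC; congr (_ + _); apply: eq_bigr => i /negbTE.
by rewrite eq_sym npullsS => ->; rewrite addn0.
Qed.

Lemma group_pulls0E A g n :
  group_pulls A g 0 n = (\sum_(i in g) npulls A i n)%N.
Proof.
rewrite /group_pulls /npulls big_mkord exchange_big /=; apply: eq_bigr => s _.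
rewrite big_mkcond /= (bigD1 (A s)) //= eqxx big1 ?addn0 => [|i].
  by case: ifP.
by rewrite eq_sym => /negbTE ->; case: ifP.
Qed.

End Pulls.

(** * Feasibility of both rules *)

Section Feasibility.
Context {R : realType} {K T : nat} (I : instance R K T).
Variables (L : R) (x : 'I_K -> nat -> R).
Implicit Types (A : nat -> 'I_K) (b : 'I_(nblocks I)) (g : {set 'I_K}).

Lemma bstop_le b : (bstop b <= T)%N.
Proof.
suff : (bstop b <= \sum_(b' < nblocks I) blen b')%N by rewrite blen_sum.
rewrite /bstop /bstart [leqRHS](bigD1 b) //= addnC leq_add2l.
rewrite [leqRHS](bigID (fun b' : 'I_(nblocks I) => (b' < b)%N)) /=.
rewrite (eq_bigl (fun b' : 'I_(nblocks I) => (b' != b) && (b' < b)%N)).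
  exact: leq_addr.
by move=> b'; rewrite -val_eqE /=; case: ltngtP.
Qed.

Lemma group_pullsS A g s n : (s <= n)%N ->
  group_pulls A g s n.+1 = (group_pulls A g s n + (A n \in g))%N.
Proof. by move=> sn; rewrite /group_pulls big_nat_recr. Qed.

(* A covering pull lowers the total deficit, and a surplus pull requires slack. *)
Lemma sum_deficit_le A b n : covering_fits I ->
  deficient_index_rule I L x A -> (n <= blen b)%N ->
  (\sum_(g in groups I) deficit A b g (bstart b + n) <= blen b - n)%N.
Proof.
move=> fits rule; elim: n => [|n IHn] nb.
  rewrite addn0 subn0; apply: leq_trans (fits b); apply: leq_sum => g _.
  exact: leq_subr.
have decr g : deficit A b g (bstart b + n.+1) =
    (deficit A b g (bstart b + n) - (A (bstart b + n)%N \in g))%N.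
  by rewrite /deficit addnS group_pullsS ?leq_addr// subnDA.
have inb : in_block b (bstart b + n) by rewrite /in_block /bstop; lia.
have [[g [gG dg [Ag _]]]|[slack _]] := rule _ _ inb.
  have := IHn (ltnW nb).
  rewrite (big_setD1 g gG) /= => IH; rewrite (big_setD1 g gG) /= decr Ag.
  have : (\sum_(h in groups I :\ g) deficit A b h (bstart b + n.+1) <=
          \sum_(h in groups I :\ g) deficit A b h (bstart b + n))%N.
    by apply: leq_sum => h _; rewrite decr leq_subr.
  (* Positivity of the chosen deficit makes the truncated [p - 1] a genuine drop by one. *)
  have arith (p q q' m : nat) :
      (0 < p -> p + q <= m -> q' <= q -> p - 1 + q' <= m.-1)%N by lia.
  by rewrite subnS; apply: arith dg IH.
have : (\sum_(h in groups I) deficit A b h (bstart b + n.+1) <=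
        \sum_(h in groups I) deficit A b h (bstart b + n))%N.
  by apply: leq_sum => h _; rewrite decr leq_subr.
(* The strict inequality [slack] says that the old total already fits in the rounds left after this
   pull. *)
move: slack; rewrite /bstop; lia.
Qed.

Lemma deficient_index_rule_feasible A : covering_fits I ->
  deficient_index_rule I L x A -> feasible I A.
Proof.
move=> fits rule b g gG.
have := sum_deficit_le fits rule (leqnn (blen b)).
by rewrite subnn leqn0 sum_nat_eq0 => /forall_inP/(_ g gG); rewrite subn_eq0.
Qed.

(** A round labelled [Some g] pulls a member of [g], so the pulls of [g] in a block are at least as
    many as its labels, which number exactly the floor. *)
Lemma D_BDQ_UCB_feasible A : D_BDQ_UCB I L x A -> feasible I A.
Proof.
move=> [lab [labE rule]] b g gG; rewrite -(labE b g gG) /group_pulls.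
rewrite big_nat_cond [leqRHS]big_nat_cond; apply: leq_sum => u.
rewrite andbT => /andP[_ ub].
case: eqP => [lu|//]; have := rule u (leq_trans ub (bstop_le b)).
by rewrite lu => -[_ [-> _]].
Qed.

(** The common property of the two rules; beyond feasibility, the regret bound uses nothing else
    about them. *)
Lemma rule_argmax A b tau :
  deficient_index_rule I L x A \/ D_BDQ_UCB I L x A -> in_block b tau ->
  exists2 g, g \in groups I \/ g = [set: 'I_K]
    & is_argmax (ucb_index L x A tau) g (A tau).
Proof.
move=> [rule|[lab [_ rule]]] inb.
  have [[g [gG _ am]]|[_ am]] := rule b tau inb.
    by exists g => //; left.
  by exists [set: 'I_K] => //; right.
have /andP[_ tb] := inb; have := rule tau (leq_trans tb (bstop_le b)).
case: (lab tau) => [g [gG am]|am].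
  by exists g => //; left.
by exists [set: 'I_K] => //; right.
Qed.

End Feasibility.

(** * Index bounds under concentration *)

Section Optimism.
Context {R : realType} {K : nat}.
Variables (T : nat) (L : R) (x : 'I_K -> nat -> R) (mu : 'I_K -> R).
Variable A : nat -> 'I_K.
Hypothesis conc : forall i n, (1 <= n <= T)%N ->
  `|emp_mean x i n - mu i| <= Defs.radius L n.

Lemma mean_le_ucb_index i tau : (tau <= T)%N -> mu i <= 1 ->
  mu i <= ucb_index L x A tau i.
Proof.
move=> tT mu1; rewrite /ucb_index; case: eqP => // /eqP; rewrite -lt0n => n0.
have nT : (1 <= npulls A i tau <= T)%N.
  by rewrite n0 (leq_trans (npulls_le _ _ _)).
rewrite le_min mu1 /=; have := conc i nT; rewrite ler_norml => /andP[]; lra.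
Qed.

(** Once [i] has been observed, [mu j] is at most the index of [j], hence at most that of [i], hence
    at most [mu i] plus two radii; squaring the gap bound gives the claim. *)
Lemma npulls_le_gap i j tau : (tau <= T)%N -> 0 <= L -> mu i <= mu j <= 1 ->
  ucb_index L x A tau j <= ucb_index L x A tau i ->
  (npulls A i tau)%:R * (mu j - mu i) ^+ 2 <= 8 * L.
Proof.
move=> tT L0 /andP[ij j1] Uji; have := le_trans (mean_le_ucb_index tT j1) Uji.
rewrite /ucb_index; case: eqP => [->|/eqP]; first by rewrite mul0r mulr_ge0.
rewrite -lt0n => n0.
have nT : (1 <= npulls A i tau <= T)%N.
  by rewrite n0 (leq_trans (npulls_le _ _ _)).
rewrite le_min => /andP[_]; have := conc i nT; rewrite ler_norml => /andP[_].
set n := npulls A i tau in n0 nT *; move=> emp_le mu_le.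
have n0R : 0 < n%:R :> R by rewrite ltr0n.
have r2 : Defs.radius L n ^+ 2 * n%:R = 2 * L.
  rewrite sqr_sqrtr ?divfK ?gt_eqF// divr_ge0 ?mulr_ge0 //; lra.
have : (mu j - mu i) ^+ 2 <= (2 * Defs.radius L n) ^+ 2.
  by rewrite ler_pXn2r ?nnegrE ?mulr_ge0 ?sqrtr_ge0 //; lra.
rewrite -(ler_pM2l n0R) => /le_trans; apply.
rewrite exprMn; nra.
Qed.

End Optimism.

(** A positive lower bound on [L] lets the term [C * L] absorb additive constants. *)
Lemma log_term_ge (R : realType) (T : nat) (eta : R) : (0 < T)%N ->
  0 < eta < 1 -> 7 / 8 <= @log_term R 4 T eta.
Proof.
move=> T0 /andP[e0 e1].
have T1 : 1 <= T%:R :> R by rewrite ler1n.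
have y8 : 8 <= 2 * 4%:R * T%:R / eta :> R by rewrite ler_pdivlMr //; nra.
apply: (@le_trans _ _ (ln 8)); last by rewrite ler_ln ?posrE //; lra.
(* From [ln (1 / 8) <= 1 / 8 - 1]. *)
have := @le_ln1Dx R (8^-1 - 1); rewrite subrKC lnV ?posrE //; lra.
Qed.

Lemma OPTfrac_ge (R : realType) (K T : nat) (I : instance R K T)
    (y : 'I_(nblocks I) -> 'I_K -> R) :
  (forall b, LP_feasible b (y b)) ->
  \sum_(b < nblocks I) LP_value I (y b) <= OPTfrac I.
Proof.
move=> yF; apply: ler_sum => b _; apply: ub_le_sup; last by exists (y b).
(* The supremum needs a bounded set: means are at most 1, so values are at most the block length. *)
exists (blen b)%:R => _ [z [z0 _ <-] ->]; apply: ler_sum => i _.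
by rewrite ler_piMl //; have /andP[] := mean01 I i.
Qed.

(* Arms 0 and 1 are private to their groups, arm 2 is shared, arm 3 is free. *)
Section Overlap.

Definition arm0 : 'I_4 := @Ordinal 4 0 isT.
Definition arm1 : 'I_4 := @Ordinal 4 1 isT.
Definition arm2 : 'I_4 := @Ordinal 4 2 isT.
Definition arm3 : 'I_4 := @Ordinal 4 3 isT.

Lemma big_arms (S : Type) (idx : S) (op : Monoid.law idx) (F : 'I_4 -> S) :
  \big[op/idx]_(i < 4) F i = op (F arm0) (op (F arm1) (op (F arm2) (F arm3))).
Proof.
rewrite !big_ord_recl big_ord0 Monoid.mulm1.
by congr (op (F _) (op (F _) (op (F _) (F _)))); apply: val_inj.
Qed.

Definition overlap_groups : {set {set 'I_4}} :=
  [set [set arm0; arm2]; [set arm1; arm2]].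

Lemma overlap_groups_neq : [set arm0; arm2] != [set arm1; arm2].
Proof. by apply/eqP => /setP/(_ arm0); rewrite !inE. Qed.

Lemma card_overlap_groups : #|overlap_groups| = 2%N.
Proof. by rewrite cards2 overlap_groups_neq. Qed.

Lemma overlap_groups_meet : ~~ finset.trivIset overlap_groups.
Proof.
apply/negP => /finset.trivIsetP/(_ [set arm0; arm2] [set arm1; arm2]).
rewrite !inE !eqxx orbT => /(_ isT isT overlap_groups_neq).
rewrite disjoint_subset => /fintype.subsetP/(_ arm2).
by rewrite !inE => /(_ isT).
Qed.

Lemma arm_degree_overlap_groups : arm_degree overlap_groups = 2%N.
Proof.
apply/eqP; rewrite eqn_leq; apply/andP; split.
  apply/bigmax_leqP => i _; rewrite -[X in (_ <= X)%N]card_overlap_groups.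
  by apply: subset_leq_card; apply/fintype.subsetP => g; rewrite inE => /andP[].
apply: leq_trans (leq_bigmax arm2); rewrite -[X in (X <= _)%N]card_overlap_groups.
apply: subset_leq_card; apply/fintype.subsetP => g gG; rewrite inE gG /=.
by move: gG; rewrite !inE => /orP[] /eqP ->; rewrite !inE eqxx orbT.
Qed.

Variable R : realType.

Definition overlap_mean (i : 'I_4) : R :=
  if i == arm2 then 2 / 5 else if i == arm3 then 1 else 1 / 2.

Lemma overlap_mean01 i : 0 <= overlap_mean i <= 1.
Proof. by rewrite /overlap_mean; case: ifP => _; [|case: ifP => _]; lra. Qed.

Variables (T : nat) (T0 : (0 < T)%N).

Lemma overlap_blen_sum : (\sum_(b < 1) T)%N = T.
Proof. by rewrite big_ord1. Qed.

(** Rounding the floors down keeps their sum within [T] when [T] is odd. *)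
Definition overlap_instance : instance R 4 T :=
  Instance overlap_mean01 overlap_groups (fun=> T0) overlap_blen_sum
    (fun _ _ => T./2).
Notation I := overlap_instance.

Lemma sum_overlap_groups (F : {set 'I_4} -> nat) :
  (\sum_(g in overlap_groups) F g = F [set arm0; arm2] + F [set arm1; arm2])%N.
Proof.
rewrite big_setU1 ?big_set1 //= inE; exact: overlap_groups_neq.
Qed.

Lemma overlap_covering_fits : covering_fits I.
Proof. by move=> b; rewrite sum_overlap_groups /=; lia. Qed.

Lemma overlap_bstart (b : 'I_(nblocks I)) : bstart b = 0%N.
Proof. by rewrite /bstart big1 // => b'; case: b b' => -[|//] ? [[|//] ?]. Qed.

Lemma overlap_bstop (b : 'I_(nblocks I)) : bstop b = T.
Proof. by rewrite /bstop overlap_bstart. Qed.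

(* One pull of the shared arm covers both groups, so [T./2] pulls suffice. *)
Lemma overlap_OPTfrac_ge : T%:R - (3 / 5) * (T./2)%:R <= OPTfrac I.
Proof.
pose y (i : 'I_4) : R := if i == arm2 then (T./2)%:R
  else if i == arm3 then T%:R - (T./2)%:R else 0.
have hT : (T./2)%:R <= T%:R :> R by rewrite ler_nat; lia.
have h0 : 0 <= (T./2)%:R :> R by [].
have y0 i : 0 <= y i.
  by rewrite /y; case: ifP => _ //; case: ifP => _; rewrite ?subr_ge0.
have yF b : @LP_feasible R 4 T I b y.
  split => // [g|]; last by rewrite big_arms /y /=; lra.
  move=> gG; have g2 : arm2 \in g.
    by move: gG; rewrite !inE => /orP[] /eqP ->; rewrite !inE eqxx orbT.
  by rewrite (bigD1 arm2) //= lerDl sumr_ge0.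
apply: le_trans (OPTfrac_ge (y := fun=> y) yF).
rewrite big_ord1 /LP_value big_arms /= /overlap_mean /y /=; lra.
Qed.

Lemma overlap_feasible_pulls A : feasible I A ->
  (T./2 <= npulls A arm0 T + npulls A arm2 T)%N /\
  (T./2 <= npulls A arm1 T + npulls A arm2 T)%N.
Proof.
move=> fA; have G0 : [set arm0; arm2] \in groups I by rewrite !inE eqxx.
have G1 : [set arm1; arm2] \in groups I by rewrite !inE eqxx orbT.
have := fA ord0 _ G0; have := fA ord0 _ G1.
rewrite overlap_bstop overlap_bstart !group_pulls0E /=.
by rewrite !big_setU1 ?inE // !big_set1.
Qed.

(** Each shared pull missing from [T./2] forces one pull of each private arm, worth 1 together,
    where a shared and a free pull would earn 7/5: a loss of 2/5. *)
Lemma overlap_regret_ge A : feasible I A ->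
  (2 / 5) * ((T./2)%:R - (npulls A arm2 T)%:R) <= regret I A.
Proof.
move=> /overlap_feasible_pulls[].
rewrite -(ler_nat R) natrD => f0; rewrite -(ler_nat R) natrD => f1.
(* The four pull counts add up to [T], which eliminates the count of [arm3]. *)
have := sum_pullsE A (fun=> 1 : R) T; rewrite sumr_const card_ord big_arms /=.
rewrite /regret sum_pullsE big_arms /= /overlap_mean /=.
have := overlap_OPTfrac_ge; lra.
Qed.

(* Whatever the rule does, a pull of the shared arm needs its index to beat
   that of a private arm, whose mean is larger by [1 / 10]. *)
Lemma overlap_shared_pulls_le (L : R) x A : 0 <= L ->
  (forall i n, (1 <= n <= T)%N ->
     `|emp_mean x i n - overlap_mean i| <= Defs.radius L n) ->
  deficient_index_rule I L x A \/ D_BDQ_UCB I L x A ->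
  (npulls A arm2 T)%:R <= 800 * L + 1.
Proof.
move=> L0 conc rule; apply: npulls_le_last => [|tau tT Atau]; first lra.
have inb : @in_block R 4 T I ord0 tau.
  by rewrite /in_block overlap_bstart overlap_bstop.
have [g gG [_]] := rule_argmax rule inb; rewrite Atau => am.
(* Either group, and the set of all arms, contains a private arm. *)
have [j jg jmu] : exists2 j, j \in g & overlap_mean j = 1 / 2.
  case: gG => [|->]; last by exists arm0.
  by rewrite !inE => /orP[]/eqP ->; [exists arm0|exists arm1]; rewrite ?inE.
(* The gap 1/10 turns [8 * L] into [800 * L]. *)
have := npulls_le_gap conc (ltnW tT) L0 _ (am j jg).
rewrite jmu /overlap_mean /= => /(_ ltac:(lra)); lra.
Qed.

End Overlap.

Theorem proposition25 (R : realType) :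
  exists (C : R) (mu : 'I_4 -> R) (G : {set {set 'I_4}}),
    [/\ #|G| = 2%N, ~~ finset.trivIset G & arm_degree G = 2%N] /\
    forall T : nat, (0 < T)%N ->
    exists I : instance R 4 T,
      [/\ mean I = mu, groups I = G & covering_fits I] /\
      forall (d : measure_display) (Omega : measurableType d)
             (P : probability Omega R) (X : 'I_4 -> nat -> {RV P >-> R})
             (eta : R) (A : Omega -> nat -> 'I_4),
        let L : R := @log_term R 4 T eta in
        reward_process mu X ->
        0 < eta < 1 ->
        (forall w, deficient_index_rule I L (sample X w) (A w) \/
                   D_BDQ_UCB I L (sample X w) (A w)) ->
        (forall w, feasible I (A w)) /\
        (forall w, conc_event T mu L X w ->
           T%:R / 20%:R - C * L <= regret I (A w)).
Proof.
(* The regret is at least 2/5 of [T./2 - 800 * L - 1], hence at least [T / 5 - 320 * L - 3 / 5]; as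
   [L >= 7 / 8], the remaining [80 * L] covers the 3/5. *)
exists 400, (@overlap_mean R), overlap_groups; split.
  split; [exact: card_overlap_groups|exact: overlap_groups_meet|].
  exact: arm_degree_overlap_groups.
move=> T T0; exists (overlap_instance R T0).
have fits : covering_fits (overlap_instance R T0) := @overlap_covering_fits _ _ _.
split=> // d Omega P X eta A L _ e01 rule.
have feas w : feasible (overlap_instance R T0) (A w).
  have [r|r] := rule w; last exact: D_BDQ_UCB_feasible r.
  exact: deficient_index_rule_feasible r.
split=> // w E; apply: le_trans (overlap_regret_ge (feas w)).
have L78 : 7 / 8 <= L := log_term_ge T0 e01.
have L0 : 0 <= L by lra.
have := overlap_shared_pulls_le L0 E (rule w).
have : T%:R <= 2 * (T./2)%:R + 1 :> R.
  by rewrite -natrM natr1 ler_nat; lia.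
have : 0 <= T%:R :> R by [].
lra.
Qed.
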